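(* The $n$-th moment of the $q$-Laguerre polynomials $L_n(x;q)$ is equal to $\mu_n^{(\ell)}(y,q)=\sum_{\sigma\in S_n}y^{\mathrm{wex}(\sigma)}q^{\mathrm{cr}(\sigma)}$. More precisely, let $\mathcal{L}_q$ be the linear functional on polynomials in $x$ defined by $\mathcal{L}_q(x^n)=\mu_n^{(\ell)}(y,q)$ for all $n\ge 0$. Then for all integers $n_1,n_2\ge 0$, $$\mathcal{L}_q\bigl(L_{n_1}(x;q)L_{n_2}(x;q)\bigr)=y^{n_1}(n_1!_q)^2\,\delta_{n_1\,n_2}.$$
   Context: Notation: $[n]_q=\frac{1-q^n}{1-q}$, $n!_q=\prod_{j=1}^n[j]_q$; $\delta$ is the Kronecker delta. The Al-Salam-Chihara polynomials $Q_n(x;\alpha,\beta|q)$ are defined by $Q_{-1}=0$, $Q_0=1$, $Q_{n+1}(x)=(2x-(\alpha+\beta)q^n)Q_n(x)-(1-q^n)(1-\alpha\beta q^{n-1})Q_{n-1}(x)$. The $q$-Laguerre polynomials (depending on a parameter $y$) are $$L_n(x;q)=\left(\frac{\sqrt y}{q-1}\right)^nQ_n\left(\frac{(q-1)x+y+1}{2\sqrt y};\frac1{\sqrt y},\sqrt y\,q\,\Big|\,q\right),$$ and they satisfy $L_{-1}(x;q)=0$, $L_0(x;q)=1$, $L_{n+1}(x;q)=(x-y[n+1]_q-[n]_q)L_n(x;q)-y[n]_q^2L_{n-1}(x;q)$. $S_n$ is the set of permutations of $[n]=\{1,\dots,n\}$. For $\sigma\in S_n$, the number of weak excedances is $\mathrm{wex}(\sigma)=\#\{i: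 1\le i\le n,\ i\le\sigma(i)\}$, and the number of crossings is $$\mathrm{cr}(\sigma)=\sum_{i=1}^n\#\{j: j<i\le\sigma(j)<\sigma(i)\}+\sum_{i=1}^n\#\{j: j>i>\sigma(j)>\sigma(i)\}.$$ In particular $\mu_0^{(\ell)}(y,q)=1$. *)

(* Defs.v *)
From HB Require Import structures.
From mathcomp Require Import all_boot all_order all_fingroup all_algebra.

Set Implicit Arguments.
Unset Strict Implicit.
Unset Printing Implicit Defensive.

Import GRing.Theory.
Local Open Scope ring_scope.

Section QNumbers.
Variables (F : fieldType) (q : F).

(* Meaningful for q != 1 only: at q = 1 the division by zero returns 0. *)
Definition qint (n : nat) : F := (1 - q ^+ n) / (1 - q).

Definition qfact (n : nat) : F := \prod_(1 <= j < n.+1) qint j.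

End QNumbers.

Section Polynomials.
Variable F : fieldType.

(* The inner match is Q_{n-1}, with Q_{-1} = 0. The truncation of n - 1 in the
   exponent is harmless, since at n = 0 the factor 1 - q ^+ n vanishes. *)
Fixpoint al_salam_chihara (a b q : F) (n : nat) : {poly F} :=
  match n with
  | 0 => 1
  | k.+1 =>
      (2%:R *: 'X - ((a + b) * q ^+ k)%:P) * al_salam_chihara a b q k
      - ((1 - q ^+ k) * (1 - a * b * q ^+ k.-1)) *:
          (match k with 0 => 0 | l.+1 => al_salam_chihara a b q l end)
  end.

(* s is a square root of y; the intended domain is 2 != 0, y != 0, q != 1. *)
Definition qLaguerre (y s q : F) (n : nat) : {poly F} :=
  (s / (q - 1)) ^+ n *:
    (al_salam_chihara s^-1 (s * q) q n
       \Po ((2%:R * s)^-1 *: ((q - 1) *: 'X + (y + 1)%:P))).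

End Polynomials.

Section Permutations.
Variable n : nat.

(* Permutations act on {0, ..., n-1} instead of {1, ..., n}; both statistics
   depend only on the relative order of the points. *)
Definition wex (sigma : {perm 'I_n}) : nat :=
  #|[set i : 'I_n | (i <= sigma i)%N]|.

Definition cr (sigma : {perm 'I_n}) : nat :=
  (\sum_(i < n)
     #|[set j : 'I_n | [&& j < i, i <= sigma j & sigma j < sigma i]]|
   + \sum_(i < n)
     #|[set j : 'I_n | [&& i < j, sigma j < i & sigma i < sigma j]]|)%N.

End Permutations.

Definition qLaguerre_moment (F : fieldType) (y q : F) (n : nat) : F :=
  \sum_(sigma : {perm 'I_n}) y ^+ wex sigma * q ^+ cr sigma.

Section Functionals.
Variable F : fieldType.

(* The linear functional sending 'X^n to mu n. *)
Definition moment_functional (mu : nat -> F) (p : {poly F}) : F :=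
  \sum_(i < size p) p`_i * mu i.

Lemma moment_functional_wide (mu : nat -> F) (p : {poly F}) (N : nat) :
  (size p <= N)%N -> moment_functional mu p = \sum_(i < N) p`_i * mu i.
Proof.
move=> le_pN; rewrite /moment_functional (big_ord_widen _ (fun i => p`_i * mu i) le_pN).
rewrite big_mkcond; apply: eq_bigr => i _; case: ltnP => // le_pi.
by rewrite nth_default ?mul0r.
Qed.

Lemma moment_functional_is_scalar (mu : nat -> F) :
  scalar (moment_functional mu).
Proof.
move=> a u v; set N := maxn (size (a *: u + v)) (maxn (size u) (size v)).
rewrite !(@moment_functional_wide mu _ N) ?leq_max ?leqnn ?orbT //.
rewrite mulr_sumr -big_split; apply: eq_bigr => i _ /=.
by rewrite coefD coefZ mulrDl mulrA.
Qed.

HB.instance Definition _ (mu : nat -> F) :=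
  GRing.isLinear.Build F {poly F} F *%R (moment_functional mu)
    (moment_functional_is_scalar mu).

Lemma moment_functionalXn (mu : nat -> F) (n : nat) :
  moment_functional mu 'X^n = mu n.
Proof.
rewrite /moment_functional size_polyXn big_ord_recr /= coefXn eqxx mul1r.
rewrite big1 ?add0r // => i _.
by rewrite coefXn (ltn_eqF (ltn_ord i)) mul0r.
Qed.

(* The moments of a sequence P of orthogonal polynomials are the values
   M 'X^n for a functional M of this kind. *)
Definition orthogonality_functional
    (P : nat -> {poly F}) (M : {scalar {poly F}}) : Prop :=
  M 1 = 1 /\ forall m n : nat, m != n -> M (P m * P n) = 0.

End Functionals.

(* Main.v *)
Require Import Defs.
From HB Require Import structures.
From mathcomp Require Import all_boot all_order all_fingroup all_algebra.
From mathcomp Require Import zify ring.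

Set Implicit Arguments.
Unset Strict Implicit.
Unset Printing Implicit Defensive.

Import GRing.Theory.
Local Open Scope ring_scope.

(* Read a permutation of m points by the h smallest of them: if none of these is
   mapped among themselves, they are h pending sources and h pending targets.
   Looking next at the image, then at the preimage, of point h, either the arc
   goes to (comes from) a larger point, and the empty h x h corner of the
   permutation matrix grows, or it joins point h to a pending target (source),
   and can be deleted with its row and column. In the latter case the number of
   crossings drops by the number of pending targets (sources) that the arc skips,
   so that summing over the choices gives [h]_q (resp. y [h+1]_q). The sums over
   permutations with an empty corner thus satisfy the recurrence of weighted
   Motzkin paths with level weights y [h+1]_q + [h]_q and down weights y [h]_q^2,
   the coefficients of the three-term recurrence of the q-Laguerre polynomials. *)

(** * Crossings and weak excedances as sums of 0/1 terms *)

Definition crossing n (sigma : {perm 'I_n}) (i j : 'I_n) : nat :=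
  ([&& j < i, i <= sigma j & sigma j < sigma i]
   + [&& i < j, sigma j < i & sigma i < sigma j])%N.

Lemma crE n (sigma : {perm 'I_n}) :
  cr sigma = (\sum_i \sum_j crossing sigma i j)%N.
Proof.
rewrite /cr -big_split; apply: eq_bigr => i _ /=.
by rewrite big_split; congr addn; rewrite cardsE -sum1_card big_mkcond.
Qed.

Lemma wexE n (sigma : {perm 'I_n}) :
  wex sigma = (\sum_(i < n) (i <= sigma i))%N.
Proof. by rewrite /wex cardsE -sum1_card big_mkcond. Qed.

Lemma sum_ord_interval n a b : (b <= n)%N ->
  (\sum_(i < n) (a <= i < b) = b - a)%N.
Proof.
move=> le_bn; rewrite -(big_mkord xpredT (fun i => (a <= i < b)%N : nat)).
elim: n b le_bn => [|n IHn] b le_bn; first by rewrite big_geq //; lia.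
rewrite big_nat_recr //=; case: (ltnP b n.+1) => [lt_bn|le_nb].
  by rewrite IHn //; lia.
have -> : b = n.+1 by lia.
rewrite (eq_big_nat _ _ (F2 := fun i => (a <= i < n)%N : nat)); last first.
  by move=> i /andP[_ lt_in]; lia.
by rewrite IHn //; lia.
Qed.

(** * Effect on the statistics of deleting an arc *)

Section LiftPerm.
Variables (n : nat) (h t : 'I_n.+1) (s : {perm 'I_n}).
Let sigma := lift_perm h t s.

Lemma cr_lift_perm :
  cr sigma = (\sum_i (crossing sigma h (lift h i) + crossing sigma (lift h i) h)
              + \sum_i \sum_j crossing sigma (lift h i) (lift h j))%N.
Proof.
rewrite crE (bigD1_ord h) //= (bigD1_ord h) //=.
have -> : crossing sigma h h = 0%N by rewrite /crossing !ltnn.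
under [X in (_ + X)%N]eq_bigr => i _ do rewrite (bigD1_ord h) //=.
by rewrite !big_split add0n /= addnA.
Qed.

Lemma wex_lift_perm :
  wex sigma = ((h <= t) + \sum_i (lift h i <= lift t (s i)))%N.
Proof.
rewrite wexE (bigD1_ord h) //= lift_perm_id; congr addn.
by apply: eq_bigr => i _; rewrite lift_perm_lift.
Qed.

Section Row.
Hypotheses (lt_th : (t < h)%N) (corner : forall i : 'I_n, (i < h)%N -> (h.-1 <= s i)%N).

(** Relabelling could alter the comparison of [i] with [s i] only if [i < h] and [s i = i - 1], but
    the corner forces [s i >= h - 1 >= i]. *)
Lemma wex_lift_perm_row : wex sigma = wex s.
Proof.
rewrite wex_lift_perm wexE (leqNgt h) lt_th; apply: eq_bigr => i _.
by have := corner (i := i); rewrite /= /bump; lia.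
Qed.

(** The deleted arc crosses exactly the arcs ending strictly between [t] and [h]: by the corner,
    they all start beyond [h]. *)
Lemma cr_lift_perm_row : cr sigma = (cr s + (h.-1 - t))%N.
Proof.
rewrite cr_lift_perm crE addnC; congr addn.
  apply: eq_bigr => i _; apply: eq_bigr => j _.
  rewrite /crossing !lift_perm_lift /= /bump.
  by have := corner (i := i); have := corner (i := j); lia.
have le_hn : (h.-1 <= n)%N by have := ltn_ord h; lia.
rewrite -(sum_ord_interval t le_hn) [RHS](reindex_inj (@perm_inj _ s)).
apply: eq_bigr => i _.
rewrite /crossing !lift_perm_lift !lift_perm_id /= /bump.
by have := corner (i := i); lia.
Qed.
End Row.

Section Column.
Hypotheses (le_ht : (h <= t)%N) (corner : forall i : 'I_n, (i < t)%N -> (t <= s i)%N).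

Lemma wex_lift_perm_column : wex sigma = (wex s).+1.
Proof.
rewrite wex_lift_perm wexE le_ht add1n; congr S; apply: eq_bigr => i _.
by have := corner (i := i); rewrite /= /bump; lia.
Qed.

(** The deleted arc crosses the arcs of [sigma] starting in [(h, t]], which by the corner all end
    beyond [t]; the weak inequality in the first kind of crossing admits the source [t] itself. *)
Lemma cr_lift_perm_column : cr sigma = (cr s + (t - h))%N.
Proof.
rewrite cr_lift_perm crE addnC; congr addn.
  apply: eq_bigr => i _; apply: eq_bigr => j _.
  rewrite /crossing !lift_perm_lift /= /bump.
  by have := corner (i := i); have := corner (i := j); lia.
have le_tn : (t <= n)%N by have := ltn_ord t; lia.
rewrite -(sum_ord_interval h le_tn); apply: eq_bigr => i _.
rewrite /crossing !lift_perm_lift !lift_perm_id /= /bump.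
by have := corner (i := i); lia.
Qed.
End Column.

End LiftPerm.

(** Deleting row [h] and column [t] inverts [lift_perm h t]. *)
Lemma reindex_lift_perm (V : nmodType) n (h t : 'I_n.+1)
    (P : pred {perm 'I_n.+1}) (G : {perm 'I_n.+1} -> V) :
  \sum_(s | P s && (s h == t)) G s =
  \sum_(s | P (lift_perm h t s)) G (lift_perm h t s).
Proof.
have inj_low (s : {perm 'I_n.+1}) :
    injective (fun k => odflt k (unlift (s h) (s (lift h k)))).
  (* [unlift] never fails here, since [s] is injective and [lift h k] differs from [h]; the default
     [k] is never returned. *)
  have lowK k : lift (s h) (odflt k (unlift (s h) (s (lift h k)))) = s (lift h k).
    have := neq_lift h k; rewrite -(can_eq (permK s)).
    by case/unlift_some=> ? ? ->.
  by move=> k l /(congr1 (lift (s h))); rewrite !lowK => /perm_inj/lift_inj.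
rewrite (reindex (lift_perm h t)) /=.
  by apply: eq_bigl => s; rewrite lift_perm_id eqxx andbT.
exists (fun s => perm (inj_low s)) => [s _|s].
  by apply/permP => k; rewrite permE lift_perm_lift lift_perm_id liftK.
case/andP=> _ /eqP sht; apply/permP => k.
case: (unliftP h k) => [l|] ->; rewrite ?lift_perm_id // lift_perm_lift -sht permE.
have := neq_lift h l; rewrite -(can_eq (permK s)).
by case/unlift_some=> ? ? ->.
Qed.

(** * Recurrence for permutations with an empty corner *)

Definition empty_corner n (a b : nat) (sigma : {perm 'I_n}) : bool :=
  [forall i : 'I_n, (i < a) ==> (b <= sigma i)]%N.

Lemma empty_cornerP n a b (sigma : {perm 'I_n}) :
  reflect (forall i : 'I_n, i < a -> b <= sigma i)%N (empty_corner a b sigma).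
Proof. by apply: (iffP forallP) => c i; have /implyP := c i. Qed.

Lemma empty_corner_lift_perm n (h t : 'I_n.+1) (s : {perm 'I_n}) a b c d :
    (forall i : 'I_n, (lift h i < a) = (i < c))%N ->
    (forall i : 'I_n, (b <= lift t i) = (d <= i))%N ->
    (h < a -> b <= t)%N ->
  empty_corner a b (lift_perm h t s) = empty_corner c d s.
Proof.
move=> hac tbd hab; apply/empty_cornerP/empty_cornerP => corner i.
  by rewrite -hac -tbd -(lift_perm_lift h); apply: corner.
case: (unliftP h i) => [k|] ->; last by rewrite lift_perm_id.
by rewrite lift_perm_lift hac tbd; apply: corner.
Qed.

Section CornerSum.
Variables (F : fieldType) (y q : F).

Lemma qint0 : qint q 0 = 0.
Proof. by rewrite /qint subrr mul0r. Qed.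

Definition corner_sum m a b : F :=
  \sum_(sigma : {perm 'I_m} | empty_corner a b sigma)
    y ^+ wex sigma * q ^+ cr sigma.

Lemma corner_sum00 m : corner_sum m 0 0 = qLaguerre_moment y q m.
Proof. by apply: eq_bigl => s; apply/empty_cornerP. Qed.

Lemma corner_sum10 m : corner_sum m 1 0 = qLaguerre_moment y q m.
Proof. by apply: eq_bigl => s; apply/empty_cornerP. Qed.

(* The weighted count of Motzkin paths of length n from height h to 0. *)
Definition open_moment n h : F := corner_sum (n + h) h h.

Lemma open_moment0 h : open_moment 0 h = (h == 0)%:R.
Proof.
case: h => [|h]; rewrite /open_moment /corner_sum.
  rewrite (bigD1 1%g) /=; last by apply/empty_cornerP => -[].
  rewrite big1 => [|s /andP[_ /eqP []]]; last by apply/permP => -[].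
  by rewrite crE wexE !big_ord0 !expr0 mulr1 addr0.
rewrite big1 // => s /empty_cornerP /(_ ord0) c.
by have := ltn_ord (s ord0); rewrite ltnNge c.
Qed.

Hypothesis q_neq1 : q != 1.

Lemma qint_sum n : qint q n = \sum_(i < n) q ^+ i.
Proof.
have nz : 1 - q != 0 by rewrite subr_eq0 eq_sym.
by apply: (mulIf nz); rewrite divfK // -opprB subrX1 -(opprB 1 q) mulNr opprK mulrC.
Qed.

(** When the arc joins the pending point [t <= h], it skips the [h - t] pending points after it. *)
Lemma qint_sum_lt n h : (h < n)%N ->
  \sum_(t < n | (t < h.+1)%N) q ^+ (h - t) = qint q h.+1.
Proof.
move=> lt_hn; rewrite qint_sum [RHS](reindex_inj rev_ord_inj).
by rewrite -(big_ord_widen n (fun t => q ^+ (h - t))).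
Qed.

(** Split on the image of point [h.+1]: beyond [h], the corner gains a row; otherwise deleting the
    arc costs the corner a column. *)
Lemma corner_sum_row m h : (h < m)%N ->
  corner_sum m.+1 h.+1 h.+1 =
  corner_sum m.+1 h.+2 h.+1 + qint q h.+1 * corner_sum m h.+1 h.
Proof.
move=> lt_hm; have lt_Hm : (h.+1 < m.+1)%N by [].
pose H := Ordinal lt_Hm.
rewrite /corner_sum (bigID (fun sigma : {perm _} => h < sigma H)%N) /=; congr (_ + _).
  apply: eq_bigl => sigma; apply/andP/empty_cornerP => [[/empty_cornerP c cH] i|c].
    rewrite ltnS leq_eqVlt => /predU1P[iH|]; last exact: c.
    by have -> : i = H by apply: val_inj.
  by split; [apply/empty_cornerP => i ltih; apply: c; lia | apply: c].
rewrite (partition_big (fun sigma : {perm _} => sigma H) (fun t => t < h.+1)%N) /=; last first.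
  by move=> sigma /andP[_]; rewrite -leqNgt.
rewrite -(@qint_sum_lt m.+1 h) ?mulr_suml; last by lia.
apply: eq_bigr => t lt_th.
rewrite (eq_bigl (fun s : {perm _} => empty_corner h.+1 h.+1 s && (s H == t))); last first.
  move=> s; rewrite -andbA; congr andb; case: eqP => [->|]; rewrite ?andbF //.
  by rewrite andbT -leqNgt.
rewrite reindex_lift_perm mulr_sumr; apply: eq_big => [s | s].
  by apply: empty_corner_lift_perm => [i|i|] /=; rewrite /bump; lia.
rewrite (@empty_corner_lift_perm _ _ _ _ _ _ h.+1 h); first last.
- by rewrite /= ltnn.
- by move=> i; rewrite /= /bump; lia.
- by move=> i; rewrite /= /bump; lia.
move=> /empty_cornerP c; rewrite wex_lift_perm_row // cr_lift_perm_row //.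
by rewrite exprD mulrA mulrC.
Qed.

(** Split on the preimage of point [h]: beyond [h], the corner gains a column; otherwise the deleted
    arc is a weak excedance, whence [y]. *)
Lemma corner_sum_column m h : (h <= m)%N ->
  corner_sum m.+1 h.+1 h =
  corner_sum m.+1 h.+1 h.+1 + y * qint q h.+1 * corner_sum m h h.
Proof.
rewrite -ltnS => lt_hm; pose H := Ordinal lt_hm.
rewrite /corner_sum (bigID (fun sigma : {perm _} => h < (sigma^-1)%g H)%N) /=; congr (_ + _).
  apply: eq_bigl => sigma; apply/andP/empty_cornerP => [[/empty_cornerP c cH] i lt_ih|c].
    rewrite ltn_neqAle c // andbT; apply/eqP => hi.
    move: cH; have -> : H = sigma i by apply: val_inj.
    by rewrite permK; lia.
  split; first by apply/empty_cornerP => i lt_ih; apply/ltnW/c.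
  by have := c ((sigma^-1)%g H); rewrite permKV /=; lia.
rewrite (partition_big (fun sigma : {perm _} => (sigma^-1)%g H) (fun t => t < h.+1)%N) /=; last first.
  by move=> sigma /andP[_]; rewrite -leqNgt.
rewrite -(@qint_sum_lt m.+1 h) // -mulrA mulr_suml mulr_sumr.
apply: eq_bigr => t lt_th.
rewrite (eq_bigl (fun s : {perm _} => empty_corner h.+1 h s && (s t == H))); last first.
  move=> s; rewrite -andbA (can2_eq (permKV s) (permK s)) eq_sym; congr andb.
  case: eqP => [<-|]; rewrite ?andbF // permK.
  by rewrite andbT -leqNgt.
rewrite reindex_lift_perm !mulr_sumr; apply: eq_big => [s | s].
  by apply: empty_corner_lift_perm => [i|i|] /=; rewrite /bump; lia.
rewrite (@empty_corner_lift_perm _ _ _ _ _ _ h h); first last.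
- by [].
- by move=> i; rewrite /= /bump; lia.
- by move=> i; rewrite /= /bump; lia.
move=> /empty_cornerP c; rewrite wex_lift_perm_column // cr_lift_perm_column //.
by rewrite exprD exprS; ring.
Qed.

(** Row step, then column step: two growths go up, one growth and one deletion give the two level
    terms, two deletions go down. *)
Lemma open_momentS n h :
  open_moment n.+1 h =
  open_moment n h.+1 + (y * qint q h.+1 + qint q h) * open_moment n h
  + y * qint q h ^+ 2 * open_moment n h.-1.
Proof.
rewrite /open_moment addSn; case: h => [|h].
  (* A corner without columns imposes nothing, so its first row is free; [qint q 0 = 0] removes the
     term at [0.-1]. *)
  rewrite corner_sum00 -corner_sum10 corner_sum_column ?leq0n // addn1 addn0.
  by rewrite qint0; ring.
rewrite corner_sum_row; last by lia.
rewrite corner_sum_column; last by lia.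
rewrite addnS corner_sum_column; last by lia.
by rewrite !addnS /=; ring.
Qed.

End CornerSum.

(** * Orthogonality from a three-term recurrence *)

Section OrthogonalPolynomials.
Variables (F : fieldType) (P : nat -> {poly F}) (b lambda : nat -> F).
Hypotheses (P0 : P 0 = 1)
  (PS : forall n, P n.+1 = ('X - (b n)%:P) * P n - lambda n *: P n.-1)
  (lambda0 : lambda 0 = 0).

Lemma three_term_monic n : P n \is monic /\ size (P n) = n.+1.
Proof.
suff: (P n \is monic /\ size (P n) = n.+1) /\ (size (P n.-1) <= n.+1)%N by case.
elim: n => [|n [[mon sz] szp]]; first by rewrite P0 monic1 size_poly1.
have szX : size (('X - (b n)%:P) * P n) = n.+2.
  by rewrite size_monicM ?monicXsubC ?monic_neq0 // size_XsubC sz.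
have lt_sz : (size (- (lambda n *: P n.-1)%R) < size (('X - (b n)%:P) * P n)%R)%N.
  by rewrite szX ltnS size_polyN (leq_trans (size_scale_leq _ _)).
split; last by rewrite /= sz.
split; last by rewrite PS size_polyDl.
by rewrite PS monicE lead_coefDl // -monicE monicMl ?monicXsubC.
Qed.

Lemma three_term_ind (Q : {poly F} -> Prop) N :
    Q 0 -> (forall a u v, Q u -> Q v -> Q (a *: u + v)) ->
    (forall n, (n < N)%N -> Q (P n)) ->
  forall p : {poly F}, (size p <= N)%N -> Q p.
Proof.
move=> Q0 QD; elim: N => [|N IHN] QP p.
  by rewrite size_poly_leq0 => /eqP ->.
move=> szp; have [mon sz] := three_term_monic N.
rewrite -(subrK (p`_N *: P N) p) addrC; apply: QD; first exact: QP.
apply: IHN => [n lt_nN|]; first by apply/QP/ltnW.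
apply/leq_sizeP => j le_Nj; rewrite coefB coefZ.
case: (ltngtP N j) le_Nj => // [lt_Nj|<-] _.
  by rewrite (nth_default _ (leq_trans szp lt_Nj)) (@nth_default _ _ (P N)) ?sz // mulr0 subrr.
have -> : (P N)`_N = 1 by move: mon; rewrite monicE lead_coefE sz => /eqP.
by rewrite mulr1 subrr.
Qed.

Lemma eq_on_three_term (M1 M2 : {scalar {poly F}}) :
  (forall n, M1 (P n) = M2 (P n)) -> M1 =1 M2.
Proof.
move=> eqM p; apply: (@three_term_ind (fun p => M1 p = M2 p) (size p)) => //.
  by rewrite !linear0.
by move=> a u v equ eqv; rewrite !linearP equ eqv.
Qed.

(* The recursion of Motzkin paths of length n from height h to 0. *)
Variable nu : nat -> nat -> F.
Hypotheses (nu0 : forall h, nu 0 h = (h == 0)%:R)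
  (nuS : forall n h,
     nu n.+1 h = nu n h.+1 + b h * nu n h + lambda h * nu n h.-1).
Variable M : {scalar {poly F}}.
Hypothesis M_Xn : forall n, M 'X^n = nu n 0.

(** Both sides obey one recurrence, which gives height [h.+2] from the two heights below; hence the
    paired induction. *)
Lemma functional_XnP n h : M ('X^n * P h) = nu n h.
Proof.
suff: M ('X^n * P h) = nu n h /\ M ('X^n * P h.+1) = nu n h.+1 by case.
elim: h n => [|h IHh] n.
  have E k : M ('X^k * P 0) = nu k 0 by rewrite P0 mulr1.
  split=> //.
  have -> : 'X^n * P 1 = 'X^(n.+1) * P 0 - b 0 *: ('X^n * P 0).
    by rewrite PS lambda0 scale0r subr0 -mul_polyC exprSr; ring.
  by rewrite linearB linearZ !E nuS lambda0 /=; ring.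
split; first by case: (IHh n).
have -> : 'X^n * P h.+2 =
    'X^(n.+1) * P h.+1 - b h.+1 *: ('X^n * P h.+1) - lambda h.+1 *: ('X^n * P h).
  by rewrite PS -!mul_polyC exprSr /=; ring.
rewrite !linearB !linearZ; case: (IHh n) => -> ->; case: (IHh n.+1) => _ ->.
by rewrite nuS /=; ring.
Qed.

Lemma nu_gt n h : (n < h)%N -> nu n h = 0.
Proof.
elim: n h => [|n IHn] [|h] //.
by move=> lt_nh; rewrite nuS !IHn //=; first ring; lia.
Qed.

(** Only the path made of [n] down steps reaches 0. *)
Lemma nu_diag n : nu n n = \prod_(1 <= j < n.+1) lambda j.
Proof.
elim: n => [|n IHn]; first by rewrite nu0 big_geq.
have lt_n2 : (n < n.+2)%N by lia.
by rewrite nuS (nu_gt lt_n2) (nu_gt (ltnSn n)) big_nat_recr //= -IHn; ring.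
Qed.

Lemma functional_mulP_lt (p : {poly F}) h : (size p <= h)%N -> M (p * P h) = 0.
Proof.
move=> le_ph; rewrite -[p]coefK poly_def mulr_suml linear_sum big1 // => i _.
rewrite -scalerAl linearZ functional_XnP nu_gt; first exact: mulr0.
exact: leq_trans (ltn_ord i) le_ph.
Qed.

Lemma functional_mulP m n :
  M (P m * P n) = (\prod_(1 <= j < m.+1) lambda j) * (m == n)%:R.
Proof.
have [mon sz] := three_term_monic m; have [_ szn] := three_term_monic n.
case: (ltngtP m n) => [lt_mn|lt_nm|<-].
- by rewrite mulr0 functional_mulP_lt // sz.
- by rewrite mulr0 mulrC functional_mulP_lt // szn.
(* [P m] can be traded for ['X^m]: their difference has lower degree and is orthogonal to [P m]. *)
rewrite mulr1 -nu_diag -functional_XnP; apply/eqP.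
rewrite -subr_eq0 -linearB -mulrBl functional_mulP_lt //.
apply/leq_sizeP => j le_mj; rewrite coefB coefXn.
case: (ltngtP m j) le_mj => // [lt_mj|<-] _.
  by rewrite nth_default ?sz // subr0.
by move: mon; rewrite monicE lead_coefE sz /= => /eqP ->; rewrite subrr.
Qed.

End OrthogonalPolynomials.

(** * Specialization to the q-Laguerre polynomials *)

Section QLaguerre.
Variables (F : fieldType) (y s q : F).
Hypotheses (two_neq0 : 2%:R != 0 :> F) (sqr_s : s ^+ 2 = y) (y_neq0 : y != 0)
  (q_neq1 : q != 1).

Lemma qLaguerre0 : qLaguerre y s q 0 = 1.
Proof. by rewrite /qLaguerre expr0 scale1r comp_polyC. Qed.

Lemma qLaguerreS n :
  qLaguerre y s q n.+1 =
  ('X - (y * qint q n.+1 + qint q n)%:P) * qLaguerre y s q n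
  - (y * qint q n ^+ 2) *: qLaguerre y s q n.-1.
Proof.
have s_neq0 : s != 0 by apply: contra_neq y_neq0 => s0; rewrite -sqr_s s0 expr0n.
have q1_neq0 : q - 1 != 0 by rewrite subr_eq0.
have q1'_neq0 : 1 - q != 0 by rewrite subr_eq0 eq_sym.
pose c := s / (q - 1); pose Q := al_salam_chihara s^-1 (s * q) q.
(* The two parameters have product [q], which makes the last coefficient a square. *)
have QS : Q n.+1 = (2%:R *: 'X - ((s^-1 + s * q) * q ^+ n)%:P) * Q n
    - (1 - q ^+ n) ^+ 2 *: Q n.-1.
  rewrite /Q /=; case: n => [|n] /=; first by rewrite expr0 !subrr expr0n !mul0r !scale0r.
  have -> : s^-1 * (s * q) * q ^+ n = q ^+ n.+1 by rewrite mulKf // exprS.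
  by rewrite expr2.
rewrite /qLaguerre -/Q -/c QS; set z := _ *: (_ + _).
rewrite comp_polyB comp_polyM comp_polyB !comp_polyZ comp_polyX comp_polyC.
(* One factor [c] makes the linear term monic; [c ^+ 2] turns [(1 - q ^+ n) ^+ 2] into
   [y * qint q n ^+ 2]. *)
rewrite scalerBr; congr (_ - _).
  rewrite exprS -scalerA scalerAr scalerAl; congr (_ * _).
  rewrite /z scalerBr !scalerDr !scalerA -addrA.
  have -> : c * 2%:R / (2%:R * s) * (q - 1) = 1.
    by rewrite /c; field; rewrite two_neq0 s_neq0.
  rewrite scale1r; congr (_ + _).
  rewrite -!mul_polyC -!polyCM -polyCB -polyCN; congr (_%:P).
  by rewrite /c /qint -sqr_s (exprS q n); field; rewrite two_neq0 s_neq0 q1_neq0 q1'_neq0.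
case: n {QS} => [|n]; first by rewrite expr0 subrr qint0 !expr0n mulr0 !scale0r scaler0.
rewrite !scalerA; congr (_ *: _).
by rewrite /c /qint -sqr_s !exprS; field; rewrite q1_neq0 q1'_neq0.
Qed.

End QLaguerre.

Theorem theorem2 (F : fieldType) (y s q : F)
    (h2 : (2%:R : F) != 0) (hs : s ^+ 2 = y) (hy : y != 0) (hq : q != 1) :
  (forall M : {scalar {poly F}},
     orthogonality_functional (qLaguerre y s q) M ->
     forall n : nat, M 'X^n = qLaguerre_moment y q n)
  /\
  (forall n1 n2 : nat,
     moment_functional (qLaguerre_moment y q)
       (qLaguerre y s q n1 * qLaguerre y s q n2)
     = y ^+ n1 * (qfact q n1) ^+ 2 * (n1 == n2)%:R).
Proof.
have P0 := qLaguerre0 y s q.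
have PS := qLaguerreS h2 hs hy hq.
have lambda0 : y * qint q 0 ^+ 2 = 0 by rewrite qint0 expr0n mulr0.
have M_Xn n : moment_functional (qLaguerre_moment y q) 'X^n = open_moment y q n 0.
  by rewrite moment_functionalXn /open_moment addn0 corner_sum00.
have orth n1 n2 : moment_functional (qLaguerre_moment y q)
    (qLaguerre y s q n1 * qLaguerre y s q n2)
    = y ^+ n1 * (qfact q n1) ^+ 2 * (n1 == n2)%:R.
  rewrite (functional_mulP P0 PS lambda0 (open_moment0 y q) (@open_momentS _ y q hq) M_Xn).
  rewrite big_split /= prodr_const_nat subn1 /= /qfact expr2 -big_split.
  by congr (_ * _ * _); apply: eq_bigr => j _; rewrite expr2.
split=> // M [M1 MP] n.
rewrite -(moment_functionalXn (qLaguerre_moment y q)).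
(* Both functionals are 1 at [P 0 = 1] and, by orthogonality to [P 0], vanish at every later
   polynomial. *)
apply: (eq_on_three_term P0 PS) => -[|k].
  have := orth 0 0; rewrite P0 M1 mulr1 /qfact big_geq // expr0 expr1n eqxx !mulr1.
  exact: esym.
have := orth 0 k.+1; rewrite P0 mul1r mulr0.
by rewrite -[in M _](mul1r (qLaguerre _ _ _ _)) -P0 MP.
Qed.
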